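(* Let $S=K[x_1,\dots,x_n]$ be a polynomial ring of dimension $n\geq 2$ over an infinite field $K$, with its standard grading. Let $M$ be a finitely generated torsionfree graded $S$-module of rank $r>1$. For $k\geq t_0(M)$ let $$0\to S(-k)^{r-1}\to M\to I(m)\to 0$$ be a graded Bourbaki sequence of $M$ with $\operatorname{grade}(I)\geq 2$. Then $$m=k\cdot(r-1)-\mathrm{e}_1(M).$$
   Context: $t_0(M)$ is the maximum degree of an element in a minimal homogeneous system of generators of $M$. A graded Bourbaki sequence is a short exact sequence $0\to F\to M\to I(m)\to 0$ of graded modules with degree-preserving maps, $F$ graded free, $I$ a graded ideal of $S$ and $m$ an integer. For a finitely generated graded $S$-module $M$ of positive dimension $s$, the Hilbert coefficients $\mathrm{e}_0(M),\dots,\mathrm{e}_{s-1}(M)$ are the integers such that for all $t\gg 0$ $$\dim_K M_t=\mathrm{e}_0(M)\binom{t+s-1}{s-1}-\mathrm{e}_1(M)\binom{t+s-2}{s-2}+\cdots+(-1)^{s-1}\mathrm{e}_{s-1}(M).$$ (Here $M$ torsionfree of positive rank has $s=n$.) *)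

(* Defs.v *)
From mathcomp Require Import all_boot all_order all_algebra.
From mathcomp Require Export mpoly.

Set Implicit Arguments.
Unset Strict Implicit.
Unset Printing Implicit Defensive.

Import GRing.Theory.
Local Open Scope ring_scope.

Definition infinite_type (T : eqType) : Prop :=
  forall s : seq T, exists x : T, x \notin s.

Section Modules.
Variables (R : comNzRingType) (M : lmodType R).

Definition in_span (g : seq M) (x : M) : Prop :=
  exists c : 'I_(size g) -> R, x = \sum_(i < size g) c i *: g`_i.

Definition generates (g : seq M) : Prop := forall x : M, in_span g x.

Definition finitely_generated : Prop := exists g : seq M, generates g.

Definition lin_indep (d : nat) (v : 'I_d -> M) : Prop :=
  forall c : 'I_d -> R, \sum_(i < d) c i *: v i = 0 -> forall i, c i = 0.

(* For R a domain: every regular element of R acts injectively. *)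
Definition torsionfree : Prop :=
  forall (a : R) (x : M), a *: x = 0 -> a = 0 \/ x = 0.

(* For R a domain with fraction field Q, this is dim_Q (Q (x)_R M) = r. *)
Definition has_rank (r : nat) : Prop :=
  (exists v : 'I_r -> M, lin_indep v) /\
  (forall v : 'I_r.+1 -> M, ~ lin_indep v).

End Modules.

Section Grade.
Variable R : comNzRingType.

(* Each s_i is a nonzerodivisor on R / (s_0, ..., s_(i-1)), and R / (s) <> 0. *)
Definition regular_seq (s : seq R) : Prop :=
  (forall i : nat, (i < size s)%N -> forall h : R,
     in_span (M := R^o) (take i s) (s`_i * h) ->
     in_span (M := R^o) (take i s) h) /\
  ~ in_span (M := R^o) s 1.

(* grade I is the supremum of the lengths of R-regular sequences in I,
   with the convention that the unit ideal has infinite grade. *)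
Definition grade_ge (I : {pred R^o}) (d : nat) : Prop :=
  (1 : R^o) \in I \/
  exists s : seq R, [/\ regular_seq s, {subset s <= I} & (d <= size s)%N].

End Grade.

Section Graded.
Variables (K : fieldType) (n : nat).
Local Notation S := {mpoly K[n]}.

(* S is viewed as a Z-graded module over itself, zero in negative degrees. *)
Definition poly_gr (d : int) : {pred S^o} :=
  fun p : S => match d with
               | Posz j => p \is j.-homog
               | Negz _ => p == 0
               end.

Definition shift_gr (T : Type) (gr : int -> {pred T}) (a : int) : int -> {pred T} :=
  fun d => gr (d + a).

Definition free_gr (gr : int -> {pred S^o}) (r : nat) : int -> {pred 'rV[S]_r} :=
  fun d v => [forall j, (v 0 j : S^o) \in gr d].

Definition sub_gr (I : {pred S^o}) : int -> {pred S^o} :=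
  fun d p => (p \in I) && (p \in poly_gr d).

Definition is_grading (M : lmodType S) (gr : int -> {pred M}) : Prop :=
  [/\ forall d, zmod_closed (gr d),
      forall (j : nat) (d : int) (p : S) (x : M),
        p \is j.-homog -> x \in gr d -> p *: x \in gr (j%:Z + d),
      forall x : M, exists (s : seq int) (y : int -> M),
        (forall d, y d \in gr d) /\ x = \sum_(d <- s) y d
    & forall (s : seq int) (y : int -> M), uniq s ->
        (forall d, y d \in gr d) -> \sum_(d <- s) y d = 0 ->
        forall d, d \in s -> y d = 0].

Definition graded_ideal (I : {pred S^o}) : Prop :=
  submod_closed I /\
  forall p : S, (p : S^o) \in I ->
    forall d : nat, (pihomog (@mdeg n) d p : S^o) \in I.

Definition minimal_homog_generators (M : lmodType S) (gr : int -> {pred M})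
    (g : seq M) : Prop :=
  [/\ forall x, x \in g -> exists d : int, x \in gr d,
      generates g
    & forall g' : seq M, subseq g' g -> generates g' -> g' = g].

(* t = t_0(M).  Minimal generators are nonzero, so their degrees are unique. *)
Definition is_t0 (M : lmodType S) (gr : int -> {pred M}) (t : int) : Prop :=
  exists g : seq M,
    [/\ minimal_homog_generators gr g,
        exists2 x, x \in g & x \in gr t
      & forall x d, x \in g -> x \in gr d -> (d <= t)%R].

(* V is a K-subspace of M of dimension d; K acts through constants of S. *)
Definition has_Kdim (M : lmodType S) (V : {pred M}) (d : nat) : Prop :=
  exists b : 'I_d -> M,
    [/\ forall i, b i \in V,
        forall x, x \in V -> exists c : 'I_d -> K, x = \sum_(i < d) (c i)%:MP *: b i
      & forall c : 'I_d -> K, \sum_(i < d) (c i)%:MP *: b i = 0 -> forall i, c i = 0].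

(* e 0, ..., e (s - 1) are the Hilbert coefficients of M, of dimension s. *)
Definition hilbert_coefs (M : lmodType S) (gr : int -> {pred M}) (s : nat)
    (e : nat -> int) : Prop :=
  exists N : nat, forall t : nat, (N <= t)%N ->
    exists2 d : nat, has_Kdim (gr t%:Z) d &
      d%:Z = \sum_(i < s) (-1) ^+ i * e i * 'C(t + (s.-1 - i), s.-1 - i)%:Z.

Definition degree_preserving (A B : lmodType S) (grA : int -> {pred A})
    (grB : int -> {pred B}) (f : A -> B) : Prop :=
  forall d x, x \in grA d -> f x \in grB d.

(* 0 -> S(-k)^q --phi--> M --psi--> I(m) -> 0, where the surjection onto I
   is given as a map psi to S whose image is I. *)
Definition graded_bourbaki (M : lmodType S) (gr : int -> {pred M}) (k : int)
    (q : nat) (I : {pred S^o}) (m : int)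
    (phi : {linear 'rV[S]_q -> M}) (psi : {linear M -> S^o}) : Prop :=
  [/\ graded_ideal I,
      degree_preserving (free_gr (r := q) (shift_gr poly_gr (- k))) gr phi
        /\ degree_preserving gr (shift_gr (sub_gr I) m) psi,
      injective phi,
      forall x, psi x = 0 <-> exists v, phi v = x
    & forall p, p \in I <-> exists x, psi x = p].

End Graded.

(* Main.v *)
From HB Require Import structures.
From mathcomp Require Import all_boot all_order all_algebra.
Require Import Defs.
From mathcomp Require Import zify ring lra.

(** Write q = r - 1 and h(j) for the number of monomials of degree j.  In
    degree d the Bourbaki sequence gives
      dim M_d = q h(d - k) + dim I_(d + m),
    so the Hilbert function of I is known for large degrees from that of M, and
    the codimension h(j) - dim I_j is eventually a polynomial in j whose two
    leading coefficients are, up to nonzero factors, r - e_0 and then, once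
    e_0 = r, m - k q + e_1.  The theorem thus says that this polynomial has
    degree at most n - 3 (is 0 if n = 2), which is the dimension count for
    grade at least 2.

    That count is made without dimension theory.  Summed up to degree T, the
    codimension is that of the polynomials of degree at most T lying in I.  A
    regular sequence f, g in I, of degrees a and b, need not be homogeneous,
    but this filtered count does not care: the multiples u f + v g of degree
    at most T obtained from u, v of degrees at most T - a, T - b satisfy only
    the relations (- h g, h f), because g is regular modulo f.  With
    p(T) the number of monomials of degree at most T, the summed codimension
    is therefore at most
      p(T) - p(T - a) - p(T - b) + p(T - a - b)                [ideal_growth]
    up to a constant.  This is a second difference of a polynomial of degree
    n, of degree at most n - 2.  The summed codimension is nondecreasing and
    eventually polynomial, so it has degree at most n - 2 as well
    [size_codim_two], and comparing coefficients of degrees n and n - 1 ends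
    the proof [shift_of_codim_two].

    Working with the summed functions throughout means that a Hilbert
    polynomial sum_i (-1)^i e_i C(t + n-1-i, n-1-i) is replaced by its
    antidifference, in which each C(t + a, a) becomes C(t + a + 1, a + 1).

    The linear algebra compares cardinals of families: free families that map
    into spans [rank_nullity_le], and spans of images [spanned_image]. *)

Set Implicit Arguments.
Unset Strict Implicit.
Unset Printing Implicit Defensive.

Import Order.TTheory GRing.Theory Num.Theory.
Local Open Scope ring_scope.

(** * Free and spanning families over a field *)

Section LinearCombinations.
Variables (K : fieldType) (V : lmodType K).

Definition lincomb (J : finType) (u : J -> V) (c : J -> K) : V :=
  \sum_j c j *: u j.

Definition kfree (J : finType) (u : J -> V) : Prop :=
  forall c : J -> K, lincomb u c = 0 -> forall j, c j = 0.

(** An upper bound for dimensions: P need not be a subspace, and no basis of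
    its span is chosen. *)
Definition spanned (P : V -> Prop) (k : nat) : Prop :=
  exists w : 'I_k -> V, forall x, P x -> exists c, x = lincomb w c.

Lemma spanned_fin (J : finType) (u : J -> V) (P : V -> Prop) :
  (forall x, P x -> exists c, x = lincomb u c) -> spanned P #|J|.
Proof.
move=> uP; exists (u \o enum_val) => x /uP[c ->].
exists (c \o enum_val).
by rewrite /lincomb (reindex _ (onW_bij _ (@enum_val_bij J))).
Qed.

Lemma spannedD (P P1 P2 : V -> Prop) (k1 k2 : nat) :
    (forall x, P x -> exists y z, [/\ P1 y, P2 z & x = y + z]) ->
  spanned P1 k1 -> spanned P2 k2 -> spanned P (k1 + k2).
Proof.
move=> dec [w1 sp1] [w2 sp2].
exists (fun i => match split i with inl j => w1 j | inr j => w2 j end).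
move=> x /dec[y [z [/sp1[c1 ->] /sp2[c2 ->] ->]]].
exists (fun i => match split i with inl j => c1 j | inr j => c2 j end).
rewrite /lincomb big_split_ord /=; congr (_ + _); apply: eq_bigr => i _.
  by rewrite (unsplitK (inl i)).
by rewrite (unsplitK (inr i)).
Qed.

Lemma kfree_enum (J : finType) (u : J -> V) (c : 'rV[K]_#|J|) :
  kfree u -> \sum_i c 0 i *: u (enum_val i) = 0 -> c = 0.
Proof.
move=> fu c0; apply/rowP=> i; rewrite mxE.
rewrite -(enum_valK i); apply: (fu (fun j => c 0 (enum_rank j))).
rewrite -c0 /lincomb (reindex _ (onW_bij _ (@enum_val_bij J))).
by apply: eq_bigr => k _; rewrite enum_valK.
Qed.

Lemma mulmx_comb (p q : nat) (c : 'rV[K]_p) (A : 'M[K]_(p, q)) (w : 'I_q -> V) :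
  \sum_l (c *m A) 0 l *: w l = \sum_i c 0 i *: \sum_l A i l *: w l.
Proof.
under [RHS]eq_bigr do rewrite scaler_sumr.
rewrite exchange_big; apply: eq_bigr => l _ /=.
by rewrite mxE scaler_suml; apply: eq_bigr => i _; rewrite scalerA.
Qed.

End LinearCombinations.

Lemma spanned_linear (K : fieldType) (U W : lmodType K) (f : {linear U -> W})
    (P : U -> Prop) (Q : W -> Prop) (k : nat) :
  (forall y, Q y -> exists2 x, P x & y = f x) -> spanned P k -> spanned Q k.
Proof.
move=> QP [w wP]; exists (f \o w) => _ /QP[x /wP[c ->] ->].
by exists c; rewrite linear_sum; apply: eq_bigr => i _; rewrite linearZ.
Qed.

Lemma sub_spanned (K : fieldType) (V : lmodType K) (P Q : V -> Prop) (k : nat) :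
  (forall x, Q x -> P x) -> spanned P k -> spanned Q k.
Proof. by move=> QP [w wP]; exists w => x /QP/wP. Qed.

Lemma coef_mx (K : fieldType) (V : lmodType K) (p q : nat)
    (x : 'I_p -> V) (w : 'I_q -> V) :
    (forall i, exists c, x i = lincomb w c) ->
  exists A : 'M[K]_(p, q), forall i, x i = \sum_l A i l *: w l.
Proof.
move=> xw.
have [A xA] : exists A : 'I_p -> {ffun 'I_q -> K},
    forall i, x i = \sum_l A i l *: w l.
  apply: (@fin_all_exists _ (fun=> _)
            (fun i (a : {ffun 'I_q -> K}) => x i = \sum_l a l *: w l)) => i.
  have [c ->] := xw i; exists [ffun l => c l].
  by apply: eq_bigr => l _; rewrite ffunE.
exists (\matrix_(i, l) A i l) => i.
by rewrite xA; apply: eq_bigr => l _; rewrite mxE.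
Qed.

Section RankNullity.
Variables (K : fieldType) (U W : lmodType K) (f : {linear U -> W}).

(** The kernel of f on the span of u has dimension at least #|J| - k by rank
    and nullity for the matrix of f, and at most q.  Only bounds enter, so
    neither the kernel nor the image has to be a space with a known basis. *)
Lemma rank_nullity_le (J : finType) (u : J -> U) (P : W -> Prop)
    (Z : U -> Prop) (k q : nat) :
    kfree u -> spanned P k -> spanned Z q -> (forall j, P (f (u j))) ->
    (forall c, f (lincomb u c) = 0 -> Z (lincomb u c)) ->
  (#|J| <= k + q)%N.
Proof.
move=> fu [w spw] [z spz] Pfu Zker; pose v i := u (@enum_val J predT i).
have [A fvA] : exists A : 'M[K]_(#|J|, k),
    forall i, f (v i) = \sum_l A i l *: w l.
  by apply: (coef_mx (x := f \o v)) => i; apply/spw/Pfu.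
(* The rows of N are the relations between the images of the vectors u j. *)
pose N := row_base (kermx A).
have NA0 : N *m A = 0 by apply/sub_kermxP; rewrite eq_row_base.
pose x i := \sum_j N i j *: v j.
have fx0 i : f (x i) = 0.
  rewrite linear_sum (eq_bigr (fun j => (row i N) 0 j *: \sum_l A j l *: w l)).
    rewrite -mulmx_comb -row_mul NA0; apply: big1 => l _.
    by rewrite !mxE scale0r.
  by move=> j _; rewrite linearZ /= fvA [in RHS]mxE.
have xE i : x i = lincomb u (fun j => N i (enum_rank j)).
  rewrite /lincomb (reindex _ (onW_bij _ (@enum_val_bij J))).
  by apply: eq_bigr => j _; rewrite enum_valK.
have [C xC] : exists C : 'M[K]_(_, q), forall i, x i = \sum_l C i l *: z l.
  apply: coef_mx => i; apply: spz; rewrite xE; apply: Zker.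
  by rewrite -xE fx0.
have C_free : row_free C.
  rewrite -kermx_eq0; apply/eqP/row_matrixP => i.
  rewrite row0; set c := row i _.
  have cC : c *m C = 0 by apply/sub_kermxP; rewrite row_sub.
  have /(kfree_enum fu) cN0 : \sum_j (c *m N) 0 j *: v j = 0.
    rewrite mulmx_comb (eq_bigr (fun i => c 0 i *: \sum_l C i l *: z l)).
      by rewrite -mulmx_comb cC; apply: big1 => l _; rewrite mxE scale0r.
    by move=> j _; rewrite -xC.
  by apply: (row_free_inj (row_base_free (kermx A))); rewrite mul0mx.
have := rank_leq_col C; rewrite (eqP C_free) mxrank_ker leq_subLR => leJ.
by rewrite (leq_trans leJ) // leq_add2r rank_leq_col.
Qed.

End RankNullity.

Section Image.
Variables (K : fieldType) (U W : lmodType K) (f : {linear U -> W}).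

(** The free family u lies in the kernel of f, so f factors through a
    complement of its span, whose dimension is #|J| - #|L|. *)
Lemma spanned_image (J L : finType) (b : J -> U) (u : L -> U) :
    kfree u -> (forall l, exists c, u l = lincomb b c) ->
    (forall l, f (u l) = 0) ->
  (#|L| <= #|J|)%N /\
  spanned (fun y => exists c, y = f (lincomb b c)) (#|J| - #|L|).
Proof.
move=> fu ub fu0; pose v i := b (@enum_val J predT i).
have vE c : lincomb b c = \sum_i c (enum_val i) *: v i.
  by rewrite /lincomb (reindex _ (onW_bij _ (@enum_val_bij J))).
have [A uA] : exists A : 'M[K]_(#|L|, #|J|),
    forall i, u (enum_val i) = \sum_j A i j *: v j.
  apply: coef_mx => i; have [c ->] := ub (enum_val i).
  by exists (c \o enum_val); rewrite vE.
have A_free : row_free A.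
  rewrite -kermx_eq0; apply/eqP/row_matrixP => i.
  rewrite row0; set c := row i _.
  have cA : c *m A = 0 by apply/sub_kermxP; rewrite row_sub.
  apply: (kfree_enum fu).
  rewrite (eq_bigr (fun i => c 0 i *: \sum_l A i l *: v l)).
    by rewrite -mulmx_comb cA; apply: big1 => l _; rewrite mxE scale0r.
  by move=> j _; rewrite -uA.
split; first by rewrite -(eqP A_free) rank_leq_col.
(* The rows of A are the coordinates of u in b; those of C span a complement,
   and only coordinates along C survive under f. *)
pose C := row_base (A^C)%MS.
have rC : \rank (A^C)%MS = (#|J| - #|L|)%N by rewrite mxrank_compl (eqP A_free).
rewrite -rC; exists (fun i => \sum_j C i j *: f (v j)) => _ [c ->].
pose c' : 'rV[K]_#|J| := \row_i c (enum_val i).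
have /sub_addsmxP[[c1 c2] /= c'E] : (c' <= A + C)%MS.
  have full := addsmx_compl_full A.
  by rewrite (adds_eqmx (eqmx_refl A) (eq_row_base _)) submx_full.
exists (fun i => c2 0 i); rewrite vE.
transitivity (\sum_j c' 0 j *: f (v j)).
  by rewrite linear_sum; apply: eq_bigr => j _; rewrite linearZ mxE.
rewrite c'E; under eq_bigr do rewrite mxE scalerDl.
rewrite big_split /= !mulmx_comb big1 ?add0r // => i _.
have := fu0 (enum_val i); rewrite uA linear_sum => fA.
by under eq_bigr do rewrite -linearZ; rewrite fA scaler0.
Qed.

End Image.

(** * Monomials of given and of bounded degree *)

Section Monomials.
Variables (n : nat) (K : fieldType).

Definition monomials_eq (d : nat) : seq 'X_{1..n.+1} :=
  [seq s2m (val t) | t <- enum (basis n.+1 d)].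

Fixpoint monomials_lt (b : nat) : seq 'X_{1..n.+1} :=
  if b is b'.+1 then monomials_lt b' ++ monomials_eq b' else [::].

Lemma mem_monomials_eq d m : (m \in monomials_eq d) = (mdeg m == d).
Proof. by rewrite basis_cover. Qed.

Lemma mem_monomials_lt b m : (m \in monomials_lt b) = (mdeg m < b)%N.
Proof.
elim: b => //= b IHb; rewrite mem_cat IHb mem_monomials_eq ltnS.
by rewrite [in RHS]leq_eqVlt orbC.
Qed.

Lemma monomials_lt_uniq b : uniq (monomials_lt b).
Proof.
elim: b => //= b IHb.
rewrite cat_uniq IHb [uniq (monomials_eq b)]uniq_basis andbT /=.
apply/hasPn => m; rewrite mem_monomials_eq mem_monomials_lt => /eqP->.
by rewrite ltnn.
Qed.

Lemma size_monomials_eq d : size (monomials_eq d) = 'C(d + n, n).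
Proof. by rewrite size_basis -bin_sub ?leq_addr // addKn. Qed.

Lemma size_monomials_lt b : size (monomials_lt b.+1) = 'C(b + n.+1, n.+1).
Proof.
elim: b => [|b IHb]; first by rewrite /= size_monomials_eq add0n !binn.
rewrite -[monomials_lt b.+2]/(monomials_lt b.+1 ++ monomials_eq b.+1).
by rewrite size_cat IHb size_monomials_eq addSnnS [in RHS]addSn [in RHS]binS.
Qed.

Definition monomial (s : seq 'X_{1..n.+1}) (m : seq_sub s) : {mpoly K[n.+1]} :=
  'X_[val m].
Arguments monomial : clear implicits.

Lemma mcoeff_lincomb s (c : seq_sub s -> K) k :
  (lincomb (monomial s) c)@_k = \sum_(m | val m == k) c m.
Proof.
rewrite raddf_sum [RHS]big_mkcond; apply: eq_bigr => m _ /=.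
by rewrite mcoeffZ mcoeffX; case: eqP; rewrite ?mulr1 ?mulr0.
Qed.

Lemma monomial_kfree s : kfree (monomial s).
Proof.
move=> c c0 m; have := mcoeff_lincomb c (val m).
by rewrite c0 mcoeff0 (big_pred1 m) // => m' /=.
Qed.

Lemma msupp_lincomb s (p : {mpoly K[n.+1]}) :
  {subset msupp p <= s} -> p = lincomb (monomial s) (fun m => p@_(val m)).
Proof.
move=> ps; apply/mpolyP => k; rewrite mcoeff_lincomb.
have [ks | kNs] := boolP (k \in s); first by rewrite (big_pred1 (SeqSub ks)).
rewrite big_pred0 => [|m]; last by apply: contraNF kNs => /eqP<-; apply: valP.
by apply/memN_msupp_eq0; apply: contra kNs => /ps.
Qed.

Lemma msize_lincomb b (c : seq_sub (monomials_lt b) -> K) :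
  (msize (lincomb (monomial (monomials_lt b)) c) <= b)%N.
Proof.
rewrite (leq_trans (msize_sum _ _ _)) //; apply/bigmax_leqP => m _.
rewrite (leq_trans (msizeZ_le _ _)) // msizeX -mem_monomials_lt.
exact: valP.
Qed.

Lemma spanned_msize b :
  spanned (fun p : {mpoly K[n.+1]} => msize p <= b)%N (size (monomials_lt b)).
Proof.
rewrite -(card_seq_sub (monomials_lt_uniq b)).
apply: (spanned_fin (u := monomial (monomials_lt b))) => p pb.
exists (fun m => p@_(val m)); apply: msupp_lincomb => m.
by move=> /msize_mdeg_lt/leq_trans/(_ pb); rewrite mem_monomials_lt.
Qed.

Lemma dhomog_lincomb d (p : {mpoly K[n.+1]}) : p \is d.-homog ->
  p = lincomb (monomial (monomials_eq d)) (fun m => p@_(val m)).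
Proof.
move=> /dhomogP pd; apply: msupp_lincomb => m /pd md.
by rewrite mem_monomials_eq -[mdeg m]/(mdeg m) md.
Qed.

Lemma spanned_dhomog d :
  spanned (fun p : {mpoly K[n.+1]} => p \is d.-homog) 'C(d + n, n).
Proof.
rewrite -size_monomials_eq -(card_seq_sub (uniq_basis _ _)).
apply: (spanned_fin (u := monomial (monomials_eq d))) => p /dhomog_lincomb pE.
by exists (fun m => p@_(val m)).
Qed.

Lemma dhomog_msize_le (d : nat) (p : {mpoly K[n.+1]}) :
  p \is d.-homog -> (msize p <= d.+1)%N.
Proof.
move=> /dhomogP pd; rewrite msizeE big_seq; apply/bigmax_leqP_seq => m mp _.
by rewrite ltnS; apply/eq_leq/(pd m mp).
Qed.

End Monomials.
Arguments monomial {n} K s.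

(** * Restriction of scalars to the base field *)

Section Restriction.
Variables (n : nat) (K : fieldType).
Local Notation S := {mpoly K[n]}.

(** The K-vector space underlying an S-module: an alias, because M itself
    already carries its scaling by S. *)
Definition restrict (M : lmodType S) : Type := M.

Section Instances.
Variable M : lmodType S.

HB.instance Definition _ := GRing.Zmodule.copy (restrict M) M.

Definition restrict_scale (c : K) (x : restrict M) : restrict M :=
  c%:MP *: (x : M).

Fact restrict_scaleA c d x :
  restrict_scale c (restrict_scale d x) = restrict_scale (c * d) x.
Proof. by rewrite /restrict_scale mpolyCM scalerA. Qed.

Fact restrict_scale1 : left_id 1 restrict_scale.
Proof. by move=> x; rewrite /restrict_scale mpolyC1 scale1r. Qed.

Fact restrict_scaleDr : right_distributive restrict_scale +%R.
Proof. by move=> c x y; apply: scalerDr. Qed.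

Fact restrict_scaleDl x : {morph restrict_scale^~ x : c d / c + d}.
Proof. by move=> c d; rewrite /restrict_scale mpolyCD scalerDl. Qed.

HB.instance Definition _ := GRing.Zmodule_isLmodule.Build K (restrict M)
  restrict_scaleA restrict_scale1 restrict_scaleDr restrict_scaleDl.

End Instances.

Section Maps.
Variables (M : lmodType S) (psi : {linear M -> S^o}).

Definition restrict_map : restrict M -> S := psi.

Fact restrict_map_is_linear : linear restrict_map.
Proof.
move=> c x y; rewrite /restrict_map [LHS](linearP psi c%:MP).
by rewrite -mul_mpolyC.
Qed.

HB.instance Definition _ :=
  GRing.isLinear.Build K (restrict M) S _ restrict_map restrict_map_is_linear.

End Maps.
End Restriction.

(** * The Bourbaki sequence degree by degree *)

Section GradedBourbaki.
Variables (n : nat) (K : fieldType).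
Local Notation S := {mpoly K[n.+1]}.
Variables (M : lmodType S) (gr : int -> {pred M}) (k m : int) (q : nat).
Variables (I : {pred S^o}) (phi : {linear 'rV[S]_q -> M}).
Variable psi : {linear M -> S^o}.
Hypothesis gradM : is_grading gr.
Hypothesis seqM : graded_bourbaki gr k I m phi psi.

Lemma gr_closed d : zmod_closed (gr d). Proof. by case: gradM. Qed.

Lemma gr_sum d (J : Type) (s : seq J) (P : pred J) (y : J -> M) :
  (forall i, P i -> y i \in gr d) -> \sum_(i <- s | P i) y i \in gr d.
Proof.
move=> yd; have [gr0 grB] := gr_closed d; elim/big_ind: _ => // x1 x2 x1d x2d.
by rewrite -[x2]opprK; apply/(grB)=> //; rewrite -sub0r; apply/grB.
Qed.

(** A preimage of p need not be homogeneous, but psi shifts degrees by m, so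
    its component of degree d is a preimage as well. *)
Lemma bourbaki_lift (d : int) (j : nat) (p : S) :
    d + m = j%:Z -> (p : S^o) \in I -> p \is j.-homog ->
  exists2 x, x \in gr d & psi x = p.
Proof.
move=> dj pI pj; have [_ [_ gr_psi] _ _ im_psi] := seqM.
have [_ _ dec _] := gradM; have [x xp] := (im_psi p).1 pI.
have [s [y [yd xE]]] := dec x.
exists (\sum_(i <- s | i == d) y i); first by apply: gr_sum => i /eqP->.
have psi_y i :
    pihomog (@mdeg n.+1) j (psi (y i)) = if i == d then psi (y i) else 0.
  have /andP[_] := gr_psi _ _ (yd i); rewrite /poly_gr.
  have -> : (i == d) = (i + m == j%:Z) by rewrite -dj (inj_eq (addIr m)).
  case: (i + m) => [l|l] /= hom_y.
    rewrite eqz_nat; case: eqVneq hom_y => [->|ne_lj] hom_y.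
      by rewrite pihomog_dE.
    by rewrite (pihomog_ne0 ne_lj).
  by move/eqP: hom_y => ->; rewrite pihomog0.
rewrite -[RHS](pihomog_dE pj) -xp xE !raddf_sum [LHS]big_mkcond /=.
by apply: eq_bigr => i _; rewrite psi_y.
Qed.

(** The image under phi of the homogeneous component of v of degree j lies in
    degree j + k.  As the degrees of M are in direct sum, only the component of
    degree d - k contributes to x. *)
Lemma bourbaki_kernel (d : int) (l : nat) (x : M) :
    d - k = l%:Z -> x \in gr d -> psi x = 0 ->
  exists2 v : 'rV[S]_q, forall i, v 0 i \is l.-homog & phi v = x.
Proof.
have [_ [gr_phi _] _ ker _] := seqM; have [_ _ _ grI] := gradM.
move=> dl xd /(ker x).1[v vx].
pose vh (j : nat) : 'rV[S]_q := \row_i pihomog (@mdeg n.+1) j (v 0 i).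
have vh_gr j : phi (vh j) \in gr (j%:Z + k).
  apply: gr_phi; apply/forallP => i; rewrite /shift_gr addrK mxE.
  exact: pihomogP.
(* Enlarged to exceed l, so that the degree d = l + k occurs in the sum. *)
pose b := maxn l.+1 (\max_i msize (v 0%R i)).
have vE : v = \sum_(j < b) vh j.
  apply/rowP => i; rewrite summxE.
  rewrite (pihomog_partitionE (mf := @mdeg n.+1) (k := b) (p := v 0 i)).
    by apply: eq_bigr => j _; rewrite mxE.
  by rewrite leq_max (leq_bigmax i) orbT.
pose y (i : int) :=
  (if i - k is Posz j then phi (vh j) else 0) - (if i == d then x else 0).
exists (vh l) => [i|]; first by rewrite mxE; apply: pihomogP.
have yd i : y i \in gr i.
  have [gr0 grB] := gr_closed i; apply: grB; last by case: eqP => // ->.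
  by case E: (i - k) => [j|j] //; rewrite -(subrK k i) E.
pose s := [seq j%:Z + k | j <- iota 0 b].
have s_uniq : uniq s.
  by rewrite map_inj_uniq ?iota_uniq // => j1 j2 /addIr[].
have ds : d \in s.
  rewrite -(subrK k d) dl; apply/mapP; exists l => //.
  by rewrite mem_iota add0n leq_max leqnn.
have sum0 : \sum_(i <- s) y i = 0.
  rewrite big_split sumrN /= -(big_mkcond (eq_op^~ d)) /=.
  have sd : [seq i <- s | i == d] = [:: d] := filter_pred1_uniq s_uniq ds.
  rewrite -[X in _ - X]big_filter sd big_seq1 big_map.
  apply/eqP; rewrite subr_eq0 -vx [in X in _ == X]vE linear_sum /=.
  rewrite -{1}[b]subn0 -/(index_iota 0 b) big_mkord; apply/eqP.
  by apply: eq_bigr => j _; rewrite addrK.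
have := grI s y s_uniq yd sum0 d ds.
by rewrite /y dl eqxx => /subr0_eq.
Qed.

(** Additivity of dimensions on the degree d part of the sequence.  The
    difference D - q C(l + n, n) is the dimension of I_j; it is obtained as an
    upper bound (a spanning family) together with the inequality expressing
    that I_j lies in S_j. *)
Lemma spanned_ideal_piece (d : int) (j l D : nat) :
    d + m = j%:Z -> d - k = l%:Z -> has_Kdim (gr d) D ->
  [/\ (q * 'C(l + n, n) <= D)%N,
      (D - q * 'C(l + n, n) <= 'C(j + n, n))%N
    & spanned (fun p : S => (p : S^o) \in I /\ p \is j.-homog)
        (D - q * 'C(l + n, n))].
Proof.
move=> dj dl [b [bd b_span b_free]].
have [_ [gr_phi gr_psi] phi_inj ker _] := seqM.
pose L : finType := ('I_q * seq_sub (monomials_eq n l))%type.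
pose u (i : L) : restrict M := phi (monomial K _ i.2 *: delta_mx 0 i.1).
pose row (c : L -> K) : 'rV[S]_q :=
  \row_i lincomb (monomial K (monomials_eq n l)) (fun t => c (i, t)).
have uE c : lincomb u c = phi (row c).
  rewrite [row c]row_sum_delta linear_sum /lincomb.
  rewrite (eq_bigr (fun i => \sum_t c (i, t) *: u (i, t))).
    by rewrite pair_big; apply: eq_bigr => -[i t] _.
  move=> i _; rewrite mxE /lincomb scaler_suml linear_sum.
  apply: eq_bigr => t _.
  by rewrite -mul_mpolyC -scalerA linearZ.
have cardL : #|L| = (q * 'C(l + n, n))%N.
  rewrite card_prod card_ord (card_seq_sub (uniq_basis _ _)).
  by rewrite size_monomials_eq.
have u_free : kfree u.
  move=> c; rewrite uE => /eqP.
  rewrite -[X in _ == X](raddf0 phi) => /eqP/phi_inj row0.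
  case=> i t; apply: (monomial_kfree (c := fun t => c (i, t))).
  by move/rowP/(_ i): row0; rewrite !mxE.
have u_gr i : (u i : M) \in gr d.
  apply: gr_phi; apply/forallP => i'; rewrite /shift_gr dl !mxE.
  rewrite eqxx /=; case: (i' == i.1); last by rewrite mulr0; apply: dhomog0.
  rewrite mulr1 -[_ \in _]/(_ \is l.-homog) dhomogX.
  by have := valP i.2; rewrite mem_monomials_eq.
have u_span i : exists c, u i = lincomb (b : 'I_D -> restrict M) c.
  by have [c cE] := b_span _ (u_gr i); exists c.
have fu0 i : restrict_map psi (u i) = 0 by apply/ker; eexists.
have [leLD spI] := spanned_image u_free u_span fu0.
rewrite cardL card_ord in leLD spI; split => //.
  rewrite leq_subLR -[X in (X <= _)%N](card_ord D) addnC.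
  apply: (rank_nullity_le (f := restrict_map psi)
    (u := b : 'I_D -> restrict M)
    (Z := fun x => (x : M) \in gr d /\ psi x = 0)
    _ (@spanned_dhomog n K j)) => //.
  - rewrite -cardL; apply: (spanned_fin (u := u)) => x [xd psix0].
    have [v v_l <-] := bourbaki_kernel dl xd psix0.
    exists (fun i => (v 0 i.1)@_(val i.2)); rewrite uE; congr (phi _).
    by apply/rowP => i; rewrite mxE; apply: dhomog_lincomb.
  - by move=> i; have /andP[_] := gr_psi _ _ (bd i); rewrite dj.
  - move=> c psic0; split=> //; rewrite /lincomb; apply: gr_sum => i _.
    have [_ grZ _ _] := gradM; rewrite -[d]add0r; apply: grZ (bd i).
    by rewrite -[_%:MP]mulr1 mul_mpolyC dhomogZ // dhomog1.
have [w wP] := spI; exists w => p [pI pj]; apply: wP.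
have [x xd <-] := bourbaki_lift dj pI pj.
by have [c ->] := b_span x xd; exists c.
Qed.

End GradedBourbaki.

(** * Growth of an ideal containing a regular sequence of length two *)

(** When 1 is in I, the pair (1, 1) will do: it satisfies the divisibility
    condition of a regular sequence although it generates the unit ideal. *)
Lemma regular_pair (R : comNzRingType) (I : {pred R^o}) : grade_ge I 2 ->
  exists f g : R, [/\ (f : R^o) \in I, (g : R^o) \in I, f != 0, g != 0
    & forall h c, h * g = c * f -> exists c', h = c' * f].
Proof.
case=> [I1 | [s [[reg proper] sI]]].
  exists 1, 1; split=> //; rewrite ?oner_neq0 // => h c; rewrite !mulr1 => ->.
  by exists c; rewrite mulr1.
case: s reg proper sI => [|f [|g s]] // reg proper sI _.
have span1P (x : R) : in_span (M := R^o) [:: f] x <-> exists c : R, x = c * f.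
  split=> [[c ->]|[c ->]]; first by exists (c ord0); rewrite big_ord1.
  by exists (fun=> c); rewrite big_ord1.
exists f, g; split.
- by apply: sI; rewrite mem_head.
- by apply: sI; rewrite !inE eqxx orbT.
- apply/eqP => f0; have [|c] := reg 0%N isT 1.
    by rewrite /= f0 mul0r; exists (fun=> 0); rewrite big_ord0.
  by rewrite /= big_ord0 => /eqP; rewrite oner_eq0.
- apply/eqP => g0; have [|c cf] := (span1P 1).1 (reg 1%N isT 1 _).
    by apply/span1P; exists 0; rewrite /= g0 !mul0r.
  apply: proper; exists (fun i : 'I_(size s).+2 => if i == ord0 then c else 0).
  rewrite big_ord_recl big1 ?addr0 // => i _.
  by rewrite /= scale0r.
move=> h c hg; apply/span1P; apply: (reg 1%N) => //.
by apply/span1P; exists c; rewrite /= mulrC.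
Qed.

Section CommonMultiples.
Variables (n : nat) (K : fieldType).
Local Notation S := {mpoly K[n]}.
Variables f g : S.

Definition bezout (ab : S * S) : S := ab.1 * f + ab.2 * g.

Fact bezout_is_linear : linear bezout.
Proof.
move=> c [a1 b1] [a2 b2]; rewrite /bezout /= !mulrDl -!scalerAl scalerDr.
by rewrite addrACA.
Qed.

HB.instance Definition _ :=
  GRing.isLinear.Build K (S * S)%type S _ bezout bezout_is_linear.

(** The Koszul relations, which are all relations between f and g when these
    form a regular sequence. *)
Definition syzygy (h : S) : S * S := (- (h * g), h * f).

Fact syzygy_is_linear : linear syzygy.
Proof.
move=> c h1 h2; congr (_, _); rewrite /= !mulrDl -!scalerAl //.
by rewrite opprD scalerN.
Qed.

HB.instance Definition _ :=
  GRing.isLinear.Build K S (S * S)%type _ syzygy syzygy_is_linear.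

End CommonMultiples.

Section IdealGrowth.
Variables (n : nat) (K : fieldType).
Local Notation S := {mpoly K[n.+1]}.
Variables (I : {pred S^o}) (N : nat) (dimI : nat -> nat).
Hypothesis gradI : graded_ideal I.
Hypothesis spanI : forall j, (N < j)%N ->
  spanned (fun p : S => (p : S^o) \in I /\ p \is j.-homog) (dimI j).

(** Being homogeneous, I contains the leading form of each of its elements:
    stripping it lowers the degree inside I. *)
Lemma spanned_ideal_msize T : (N <= T)%N ->
  spanned (fun p : S => (p : S^o) \in I /\ msize p <= T.+1)%N
    ('C(N + n.+1, n.+1) + \sum_(N.+1 <= j < T.+1) dimI j).
Proof.
have [[_ Icl] Ihom] := gradI.
elim: T => [|T IHT]; first rewrite leqn0 => /eqP->.
  rewrite big_geq // addn0 -size_monomials_lt.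
  by apply: sub_spanned (spanned_msize _ _ _) => p [].
rewrite leq_eqVlt => /predU1P[-> | ltNT].
  rewrite big_geq // addn0 -size_monomials_lt.
  by apply: sub_spanned (spanned_msize _ _ _) => p [].
rewrite big_nat_recr //= addnA; apply: spannedD (IHT ltNT) (spanI _) => //.
move=> p [pI pT]; pose q := pihomog (@mdeg n.+1) T.+1 p.
have qI : (q : S^o) \in I by apply: Ihom.
exists (p - q), q; split; last 2 first.
- by split=> //; apply: pihomogP.
- by rewrite subrK.
split; first by have := Icl (-1) q p qI pI; rewrite scaleN1r addrC.
rewrite {1}(pihomog_partitionE (mf := @mdeg n.+1) pT) big_ord_recr /= addrK.
rewrite (leq_trans (msize_sum _ _ _)) //; apply/bigmax_leqP => j _.
by rewrite (leq_trans (dhomog_msize_le (pihomogP _ _ _))).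
Qed.

Variables (f g : S).
Hypotheses (fI : (f : S^o) \in I) (gI : (g : S^o) \in I).
Hypotheses (f0 : f != 0) (g0 : g != 0).
Hypothesis fg_reg : forall h c : S, h * g = c * f -> exists c', h = c' * f.

(** The polynomials u f + v g with u of degree at most T - a and v of degree
    at most T - b lie in I and have degree at most T; the relations between
    them are the h (- g, f) with h of degree at most T - a - b. *)
Lemma ideal_growth (T a b : nat) :
    msize f = a.+1 -> msize g = b.+1 -> (N <= T)%N -> (a + b <= T)%N ->
  ('C(T - a + n.+1, n.+1) + 'C(T - b + n.+1, n.+1) <=
   'C(N + n.+1, n.+1) + \sum_(N.+1 <= j < T.+1) dimI j
     + 'C(T - (a + b) + n.+1, n.+1))%N.
Proof.
move=> fa gb leNT leabT; have [[I0 Icl] _] := gradI.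
have Imul c p : (p : S^o) \in I -> (c * p : S^o) \in I.
  by move=> pI; have := Icl c p 0 pI I0; rewrite addr0.
pose J : finType := (seq_sub (monomials_lt n (T - a).+1)
                     + seq_sub (monomials_lt n (T - b).+1))%type.
pose u (j : J) : S * S := match j with
  | inl s => (monomial K _ s, 0) | inr s => (0, monomial K _ s) end.
have uE c : lincomb u c = (lincomb (monomial K _) (c \o inl),
                           lincomb (monomial K _) (c \o inr)).
  rewrite /lincomb big_sumType /= [LHS]surjective_pairing; congr (_, _).
    rewrite /= !raddf_sum.
    rewrite [X in _ + X]big1 => [|s _] /=; last by rewrite scaler0.
    by rewrite addr0; apply: eq_bigr.
  rewrite /= !raddf_sum [X in X + _]big1 => [|s _] /=; last by rewrite scaler0.
  by rewrite add0r; apply: eq_bigr.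
have cardJ : #|J| = ('C(T - a + n.+1, n.+1) + 'C(T - b + n.+1, n.+1))%N.
  by rewrite card_sum !card_seq_sub ?monomials_lt_uniq // !size_monomials_lt.
rewrite -cardJ; apply: (rank_nullity_le (f := bezout f g) (u := u)
  (Z := fun x => exists2 h, (msize h <= (T - (a + b)).+1)%N & x = syzygy f g h)
  _ (spanned_ideal_msize leNT)).
- move=> c; rewrite uE => -[c1 c2] [] s.
    exact: (monomial_kfree (c := c \o inl)).
  exact: (monomial_kfree (c := c \o inr)).
- rewrite -size_monomials_lt.
  exact: (spanned_linear (f := syzygy f g)) _ (@spanned_msize n K _).
- have small (p : S) e (s : seq_sub (monomials_lt n (T - e).+1)) :
      p != 0 -> msize p = e.+1 -> (e <= T)%N ->
      (msize (monomial K _ s * p) <= T.+1)%N.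
    move=> p0 pe leeT; rewrite /monomial msizeM -?msize_poly_eq0 ?msizeX ?pe //.
    by have := valP s; rewrite mem_monomials_lt; lia.
  case=> s; rewrite /= /bezout /= mul0r ?addr0 ?add0r; split.
  + exact: Imul.
  + by apply: small => //; lia.
  + exact: Imul.
  + by apply: small => //; lia.
move=> c; rewrite uE /bezout /=; set x := lincomb _ _; set y := lincomb _ _.
have yb : (msize y <= (T - b).+1)%N by apply: msize_lincomb.
move=> xy0; have /fg_reg[h hE] : y * g = - x * f.
  by apply/eqP; rewrite mulNr -addr_eq0 addrC; apply/eqP.
exists h.
  have [->|h0] := eqVneq h 0; first by rewrite msize0.
  move: yb; rewrite hE msizeM // fa; move: (mmeasure _ h) => s; lia.
congr (_, _) => //; apply: (mulIf f0); apply/eqP.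
rewrite -subr_eq0 -xy0 /bezout /= hE; apply/eqP; ring.
Qed.

End IdealGrowth.

(** * Polynomials bounded on large integers *)

(** By induction on the Horner form: if l is the leading coefficient and
    p.[x] >= l, then p.[x] * x + a >= l x - |a| >= l for x >= 1 + |a| / l. *)
Lemma poly_ge_lead_coef (R : realFieldType) (p : {poly R}) :
  0 < lead_coef p -> exists x0, forall x, x0 <= x -> lead_coef p <= p.[x].
Proof.
elim/poly_ind: p => [|p a IHp]; first by rewrite lead_coef0 ltxx.
have [-> | p0] := eqVneq p 0.
  by rewrite mul0r add0r lead_coefC => _; exists 0 => x _; rewrite hornerC.
have -> : lead_coef (p * 'X + a%:P) = lead_coef p.
  rewrite lead_coefDl ?lead_coefMX // size_mulX //.
  by rewrite (leq_ltn_trans (size_polyC_leq1 _)) // ltnS size_poly_gt0.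
move=> lp; have [x0 px] := IHp lp; set l := lead_coef p in lp px *.
exists (Num.max x0 (1 + `|a| / l)) => x; rewrite ge_max => /andP[/px plx x1].
have xl : l + `|a| <= l * x.
  rewrite -(ler_pM2l lp) in x1.
  by rewrite mulrDr mulr1 mulrCA divff ?mulr1 ?gt_eqF in x1.
have x_ge0 : 0 <= x by apply: le_trans x1; rewrite addr_ge0 ?divr_ge0 // ltW.
rewrite hornerMXaddC; have := ler_wpM2r x_ge0 plx; have := ler_norm (- a).
rewrite normrN; lra.
Qed.

Lemma lead_coef_ge0 (p : {poly rat}) (N : nat) :
  (forall T, (N <= T)%N -> 0 <= p.[T%:R]) -> 0 <= lead_coef p.
Proof.
move=> p_ge0; rewrite leNgt; apply/negP => lp.
have [|x0 px] := @poly_ge_lead_coef _ (- p).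
  by rewrite lead_coefN oppr_gt0.
pose T := (N + Num.bound `|x0|)%N.
have /px : x0 <= T%:R.
  apply: le_trans (ler_norm _) _.
  apply/ltW/(lt_le_trans (archi_boundP (normr_ge0 _))).
  by rewrite ler_nat leq_addl.
have := p_ge0 T (leq_addr _ _); rewrite lead_coefN hornerN; lra.
Qed.

(** Since p is eventually nondecreasing, its leading coefficient is
    nonnegative; were its degree positive and larger than that of q, the
    leading coefficient of q + c - p would be its opposite and nonnegative
    too. *)
Lemma size_le_of_bounds (p q : {poly rat}) (c : rat) (N : nat) :
    (forall T, (N <= T)%N -> p.[T%:R] <= p.[T.+1%:R]) ->
    (forall T, (N <= T)%N -> p.[T%:R] <= q.[T%:R] + c) ->
  (size p <= maxn 1 (size q))%N.
Proof.
move=> p_incr p_le; rewrite leqNgt gtn_max; apply/negP => /andP[p_gt1 ltqp].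
have p_ge T : (N <= T)%N -> p.[N%:R] <= p.[T%:R].
  move/subnKC <-; elim: (T - N)%N => [|t IHt]; first by rewrite addn0.
  by rewrite addnS; apply: le_trans IHt (p_incr _ (leq_addr _ _)).
have ltcp a : (size (a%:P : {poly rat}) < size p)%N.
  exact: leq_ltn_trans (size_polyC_leq1 _) p_gt1.
have lp_ge0 : 0 <= lead_coef p.
  have <- : lead_coef (p - (p.[N%:R])%:P) = lead_coef p.
    by rewrite lead_coefDl // size_polyN.
  by apply: (@lead_coef_ge0 _ N) => T /p_ge; rewrite !hornerE subr_ge0.
have lp_le0 : 0 <= - lead_coef p.
  have <- : lead_coef (- p + (q + c%:P)) = - lead_coef p.
    rewrite lead_coefDl ?lead_coefN // size_polyN.
    by rewrite (leq_ltn_trans (size_polyD _ _)) // gtn_max ltqp ltcp.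
  apply: (@lead_coef_ge0 _ N) => T /p_le pq.
  by rewrite hornerD hornerN hornerD hornerC addrC subr_ge0.
have /eqP : lead_coef p = 0 by apply/le_anti; rewrite lp_ge0 -oppr_ge0 lp_le0.
by rewrite lead_coef_eq0 -size_poly_leq0 leqNgt (ltn_trans _ p_gt1).
Qed.

(** * Translates and binomial polynomials *)

Section Translation.
Variable R : comNzRingType.
Implicit Types (p : {poly R}) (c x : R).

Definition translate c p := p \Po ('X + c%:P).

Lemma horner_translate c p x : (translate c p).[x] = p.[x + c].
Proof. by rewrite horner_comp !hornerE. Qed.

(** The two leading terms of Taylor's formula. *)
Lemma coef_translate c p d : (size p <= d.+2)%N ->
  (translate c p)`_d.+1 = p`_d.+1 /\
  (translate c p)`_d = p`_d + c *+ d.+1 * p`_d.+1.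
Proof.
elim/poly_ind: p d => [|p a IHp] d.
  by rewrite /translate comp_poly0 !coef0 mulr0 addr0.
rewrite size_MXaddC => sz.
have {sz} sz : (size p <= d.+1)%N.
  by case: ifP sz => [/andP[/eqP-> _]|_ //]; rewrite size_poly0.
rewrite /translate comp_poly_MXaddC -/(translate c p) mulrDr.
have [tp1 tp0] := IHp d (leqW sz).
have p_d1 : p`_d.+1 = 0 by rewrite nth_default.
rewrite !coefD !coefMX !coefMC !coefC /= tp1 p_d1 mul0r !addr0.
case: d sz tp1 tp0 p_d1 => [|d] sz tp1 tp0 p_d1 /=.
  rewrite tp0 p_d1 mulr0 addr0 add0r addrC mulr1n.
  by rewrite add0r mulrC.
have [tp1' tp0'] := IHp d sz.
rewrite tp1' tp0'; split=> //; ring.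
Qed.

Lemma size_diff_translate c p d :
  (size p <= d.+2)%N -> (size (p - translate c p)%R <= d.+1)%N.
Proof.
move=> sz; apply/leq_sizeP => -[//|j] ltdj.
by rewrite coefB (coef_translate _ _).1 ?subrr // (leq_trans sz).
Qed.

End Translation.

(** The polynomial with values C(t + j, j), that is (X + 1) ... (X + j) / j!;
    its value at T, for j the number of variables, counts the monomials of
    degree at most T. *)
Fixpoint binpoly (j : nat) : {poly rat} :=
  if j is j'.+1 then j%:R^-1 *: (binpoly j' * ('X + j%:R%:P)) else 1.

Arguments binpoly : simpl never.

Lemma binpolyS j :
  binpoly j.+1 = j.+1%:R^-1 *: (binpoly j * ('X + j.+1%:R%:P)).
Proof. by []. Qed.

Lemma horner_binpoly j t : (binpoly j).[t%:R] = 'C(t + j, j)%:R.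
Proof.
elim: j => [|j IHj]; first by rewrite hornerE bin0.
have j0 : j.+1%:R != 0 :> rat by rewrite pnatr_eq0.
apply: (mulfI j0); rewrite binpolyS hornerZ mulrA divff // mul1r hornerM IHj.
rewrite !hornerE.
by rewrite -natrD -!natrM -mul_bin_diag mulnC addnS.
Qed.

Lemma size_binpoly j : (size (binpoly j) <= j.+1)%N.
Proof.
elim: j => [|j IHj]; first by rewrite size_poly1.
rewrite (leq_trans (size_scale_leq _ _)) // (leq_trans (size_polyMleq _ _)) //.
by rewrite size_XaddC addn2 ltnS.
Qed.

Lemma coef_binpolyS j : (binpoly j.+1)`_j.+1 *+ j.+1 = (binpoly j)`_j.
Proof.
rewrite binpolyS coefZ mulrDr coefD coefMX coefMC /=.
rewrite (nth_default _ (size_binpoly j)).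
by rewrite mul0r addr0 -mulrnAl -(mulr_natr _^-1) mulVf ?mul1r // pnatr_eq0.
Qed.

Lemma coef_binpoly_neq0 j : (binpoly j)`_j != 0.
Proof.
elim: j => [|j]; first by rewrite coef1 oner_neq0.
by rewrite -coef_binpolyS mulrn_eq0.
Qed.

Lemma horner_binpoly_diff j t :
  (binpoly j.+1).[t.+1%:R] - (binpoly j.+1).[t%:R] = 'C(t.+1 + j, j)%:R.
Proof.
by rewrite !horner_binpoly addSn binS natrD addSnnS addrAC subrr add0r.
Qed.

(** * Comparison of Hilbert polynomials *)

(** Up to constants, E is the summed Hilbert polynomial of I and the polynomial
    in the conclusion is the summed codimension: it is nondecreasing, and
    bounded by the second difference D2 of the number of monomials. *)
Lemma size_codim_two (n N a b : nat) (dimI : nat -> nat) (E : {poly rat}) :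
    (forall j, (N <= j)%N -> (dimI j.+1)%:R = E.[j.+1%:R] - E.[j%:R]) ->
    (forall j, (N <= j)%N -> (dimI j.+1 <= 'C(j.+1 + n.+1, n.+1))%N) ->
    (forall T, (N <= T)%N -> (a + b <= T)%N ->
      ('C(T - a + n.+2, n.+2) + 'C(T - b + n.+2, n.+2) <=
       'C(N + n.+2, n.+2) + \sum_(N.+1 <= j < T.+1) dimI j
         + 'C(T - (a + b) + n.+2, n.+2))%N) ->
  (size (binpoly n.+2 - E)%R <= n.+1)%N.
Proof.
move=> dimE dim_le growth; set B := binpoly n.+2.
pose D1 := B - translate (- a%:R) B; pose D2 := D1 - translate (- b%:R) D1.
have sD2 : (size D2 <= n.+1)%N.
  by do 2!apply: size_diff_translate; apply: size_binpoly.
apply: leq_trans (_ : maxn 1 (size D2) <= _)%N; last by rewrite geq_max.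
have sumE T : (N <= T)%N ->
    (\sum_(N.+1 <= j < T.+1) dimI j)%:R = E.[T%:R] - E.[N%:R].
  move/subnKC <-; elim: (T - N)%N => [|t IHt].
    by rewrite addn0 big_geq // subrr.
  rewrite addnS big_nat_recr ?ltnS ?leq_addr //= natrD IHt dimE ?leq_addr //.
  ring.
apply: (@size_le_of_bounds _ _ (B - E).[N%:R] (N + (a + b))) => T leT.
  have leNT : (N <= T)%N := leq_trans (leq_addr _ _) leT.
  have := dim_le _ leNT; rewrite -(ler_nat rat) dimE // -horner_binpoly_diff.
  rewrite !hornerE -/B; lra.
have leabT : (a + b <= T)%N := leq_trans (leq_addl _ _) leT.
have := growth _ (leq_trans (leq_addr _ _) leT) leabT.
rewrite -(ler_nat rat) !natrD -!horner_binpoly.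
rewrite sumE ?(leq_trans (leq_addr _ _) leT) //.
rewrite !natrB ?(leq_trans _ leabT) ?leq_addr ?leq_addl // -/B.
rewrite !hornerD !hornerN !horner_translate !hornerD !hornerN !horner_translate.
have -> : T%:R - (a + b)%:R = T%:R - b%:R - a%:R :> rat by rewrite natrD; ring.
lra.
Qed.

Section HilbertCoefficients.
Variables (n : nat) (e : nat -> int).

Definition hilbert_fun (t : nat) : int :=
  \sum_(i < n.+2) (-1) ^+ i * e i * 'C(t + (n.+1 - i), n.+1 - i)%:Z.

(** An antidifference of the Hilbert polynomial: by Pascal's rule it suffices
    to replace each C(t + a, a) by C(t + a + 1, a + 1). *)
Definition hilbert_sum : {poly rat} :=
  \sum_(i < n.+2) ((-1) ^+ i * e i)%:~R *: binpoly (n.+2 - i).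

Lemma hilbert_sum_diff t :
  hilbert_sum.[t.+1%:R] - hilbert_sum.[t%:R] = (hilbert_fun t.+1)%:~R.
Proof.
rewrite /hilbert_sum /hilbert_fun !horner_sum -sumrB rmorph_sum.
apply: eq_bigr => i _; have lein : (i <= n.+1)%N by rewrite -ltnS.
rewrite !hornerZ -mulrBr (subSn lein) horner_binpoly_diff.
by rewrite [RHS]intrM.
Qed.

Lemma size_hilbert_sum : (size hilbert_sum <= n.+3)%N.
Proof.
rewrite (leq_trans (size_sum _ _ _)) //; apply/bigmax_leqP => i _.
rewrite (leq_trans (size_scale_leq _ _)) // (leq_trans (size_binpoly _)) //.
by rewrite ltnS leq_subr.
Qed.

Lemma coef_hilbert_sum :
  hilbert_sum`_n.+2 = (e 0%N)%:~R * (binpoly n.+2)`_n.+2 /\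
  hilbert_sum`_n.+1 = (e 0%N)%:~R * (binpoly n.+2)`_n.+1
                      - (e 1%N)%:~R * (binpoly n.+1)`_n.+1.
Proof.
rewrite /hilbert_sum !big_ord_recl; set rest := \sum_(i < n) _.
have s_rest : (size rest <= n.+1)%N.
  rewrite (leq_trans (size_sum _ _ _)) //; apply/bigmax_leqP => i _.
  rewrite (leq_trans (size_scale_leq _ _)) // (leq_trans (size_binpoly _)) //=.
  by rewrite /bump /=; lia.
have r2 : rest`_n.+2 = 0 by rewrite nth_default // leqW.
have r1 : rest`_n.+1 = 0 by rewrite nth_default.
have b1 : (binpoly n.+1)`_n.+2 = 0 by rewrite nth_default // size_binpoly.
rewrite !coefD r1 r2 !(coefZ ((-1) ^+ _ * _)%:~R) -[nat_of_ord ord0]/0%N.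
rewrite -[nat_of_ord (lift _ _)]/1%N -[(n.+2 - 0)%N]/n.+2 -[(n.+2 - 1)%N]/n.+1.
by rewrite b1 expr0 expr1 mul1r mulN1r rmorphN !mulr0 !addr0 mulNr.
Qed.

End HilbertCoefficients.

(** The coefficient of degree n + 2 forces e_0 = 1 + q.  In degree n + 1 the
    subleading coefficients of the binomial polynomials then cancel, and what
    remains is a multiple of e_1 + m - q k. *)
Lemma shift_of_codim_two (n q : nat) (e : nat -> int) (m k : int) :
    (size (binpoly n.+2 - (translate (- m%:~R) (hilbert_sum n e)
       - q%:R *: translate (- (m + k)%:~R) (binpoly n.+2)))%R <= n.+1)%N ->
  m = k * q%:Z - e 1%N.
Proof.
move=> sz.
have [H2 H1] := coef_hilbert_sum n e.
have [tH2 tH1] := coef_translate (- m%:~R) (size_hilbert_sum n e).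
have [tB2 tB1] := coef_translate (- (m + k)%:~R) (size_binpoly n.+2).
have LE := coef_binpolyS n.+1; set B := binpoly n.+2 in sz H1 H2 tB1 tB2 LE *.
set L := B`_n.+2 in H2 tB1 tB2 LE.
have L0 : L != 0 := coef_binpoly_neq0 n.+2.
have z2 := nth_default 0 (leqW sz); have z1 := nth_default 0 sz.
rewrite coefB coefB (coefZ q%:R) tH2 H2 tB2 -/L in z2.
rewrite coefB coefB (coefZ q%:R) tH1 H1 H2 tB1 -LE in z1.
have e0 : (e 0%N)%:~R = 1 + q%:R :> rat.
  apply: (mulIf L0); apply/eqP; rewrite -subr_eq0 -oppr_eq0 -z2.
  by apply/eqP; ring.
rewrite e0 in z1.
have L1 : n.+2%:R * L != 0 by rewrite mulf_neq0 // pnatr_eq0.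
suff /eqP : (m + e 1%N)%:~R = (k * q%:Z)%:~R :> rat.
  by rewrite eqr_int => /eqP <-; rewrite addrK.
rewrite !rmorphD rmorphM /=.
apply: (mulIf L1); apply/eqP; rewrite -subr_eq0 -z1; apply/eqP.
rewrite rmorphD /=. ring.
Qed.

Theorem theorem3p1 (K : fieldType) (n : nat)
  (M : lmodType {mpoly K[n]}) (gr : int -> {pred M}) (r : nat)
  (e : nat -> int) (t0 k m : int) (I : {pred {mpoly K[n]}^o})
  (phi : {linear 'rV[{mpoly K[n]}]_(r.-1) -> M})
  (psi : {linear M -> {mpoly K[n]}^o}) :
  infinite_type K ->
  (2 <= n)%N ->
  is_grading gr ->
  finitely_generated M ->
  torsionfree M ->
  has_rank M r ->
  (1 < r)%N ->
  hilbert_coefs gr n e ->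
  is_t0 gr t0 ->
  t0 <= k ->
  graded_bourbaki gr k I m phi psi ->
  grade_ge I 2 ->
  m = k * (r%:Z - 1) - e 1%N.
Proof.
case: n M gr I phi psi => [|[|n]] // M gr I phi psi _ _ gradM _ _ _ r_gt1.
move=> [N0 hilbM] _ _ seqM /regular_pair[f [g [fI gI f0 g0 fg_reg]]].
have gradI : graded_ideal I by case: seqM.
have -> : r%:Z - 1 = r.-1%:Z by lia.
move: r.-1 phi seqM => q phi seqM {r r_gt1}.
pose t j := absz (j%:Z - m)%R; pose l j := absz (j%:Z - m - k)%R.
(* The dimension of I_j for large j, and an arbitrary value for small j. *)
pose dimI j : nat :=
  (`|hilbert_fun n e (t j)|%N - q * 'C(l j + n.+1, n.+1))%N.
(* From N on, j - m and j - m - k are natural numbers and j - m >= N0. *)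
pose N := (N0 + `|m| + `|k|)%N.
have tE j : (N <= j)%N -> (t j)%:Z = j%:Z - m by rewrite /t /N; lia.
have lE j : (N <= j)%N -> (l j)%:Z = j%:Z - m - k by rewrite /l /N; lia.
have tS j : (N <= j)%N -> t j.+1 = (t j).+1 by rewrite /t /N; lia.
have lS j : (N <= j)%N -> l j.+1 = (l j).+1 by rewrite /l /N; lia.
have piece j : (N <= j)%N ->
  [/\ (dimI j)%:Z = hilbert_fun n e (t j) - (q * 'C(l j + n.+1, n.+1))%:Z,
      (dimI j <= 'C(j + n.+1, n.+1))%N
    & spanned (fun p => (p : {mpoly K[n.+2]}^o) \in I /\ p \is j.-homog)
        (dimI j)].
  move=> leNj; have [|D dimD DE] := hilbM (t j); first by rewrite /t; lia.
  have hD : `|hilbert_fun n e (t j)|%N = D by rewrite -[hilbert_fun n e _]DE.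
  have [||le1 le2 sp] :=
    spanned_ideal_piece (j := j) (l := l j) gradM seqM _ _ dimD.
  - by rewrite tE // subrK.
  - by rewrite tE // lE.
  by rewrite /dimI hD -[hilbert_fun n e _]DE; split=> //; lia.
have tR j : (N <= j)%N -> j%:R - m%:~R = (t j)%:R :> rat.
  by move=> leNj; rewrite -[RHS]/((t j)%:Z%:~R) tE // rmorphB.
have lR j : (N <= j)%N -> j%:R - (m + k)%:~R = (l j)%:R :> rat.
  move=> leNj; rewrite -[RHS]/((l j)%:Z%:~R) lE // !rmorphB rmorphD /=.
  by rewrite opprD addrA.
apply: (@shift_of_codim_two n).
apply: (@size_codim_two _ N (msize f).-1 (msize g).-1 dimI).
- move=> j leNj; have leNj1 := leqW leNj.
  have [dE _ _] := piece _ leNj1.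
  rewrite -[LHS]/((dimI j.+1)%:Z%:~R) dE tS // lS //.
  rewrite !hornerD !hornerN !hornerZ !horner_translate.
  rewrite !(tR, lR) // tS // lS //.
  rewrite rmorphB /= -hilbert_sum_diff -[X in _ - X]/(_%:R) natrM.
  rewrite -horner_binpoly_diff.
  ring.
- by move=> j leNj; have [] := piece _ (leqW leNj).
move=> T leNT leabT.
apply: (ideal_growth gradI _ fI gI f0 g0 fg_reg) => //.
- by move=> j ltNj; have [] := piece _ (ltnW ltNj).
- by rewrite prednK // lt0n msize_poly_eq0.
- by rewrite prednK // lt0n msize_poly_eq0.
Qed.
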